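(* Let $\lambda=(\lambda_1>\lambda_2>\cdots>\lambda_\ell\ge 1)$ be a strict partition. The average, over all $t\in{\sf hrSYT}(\lambda)$, of the number of braid hooks of $t$ is at most $1/2$. If moreover $\lambda_1\ge\lambda_2+2$ and $\lambda_\ell=1$, then this average is exactly $1/2$.
   Context: The half-right-justified diagram of a strict partition $\lambda$ consists of cells $(r,c)$ (row $r$ top to bottom, column $c$ left to right) with $1\le r\le\ell$ and $\lambda_1-(r-1)-\lambda_r+1\le c\le\lambda_1-(r-1)$; i.e. row $r$ has $\lambda_r$ cells and its rightmost cell lies one step down and one step left of the rightmost cell of row $r-1$. ${\sf hrSYT}(\lambda)$ is the set of bijective fillings of these cells by $1,\ldots,|\lambda|$ increasing along rows (left to right) and along columns (top to bottom). An integer $k$ is a braid hook of $t$ if there is a cell $(r,c)$ with $k-1$ in $(r,c)$, $k$ in $(r,c+1)$, $k+1$ in $(r+1,c+1)$, and $(r+1,c)$ not a cell of the diagram. *)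

(* Defs.v *)
From mathcomp Require Import all_boot all_order all_algebra.

Set Implicit Arguments.
Unset Strict Implicit.
Unset Printing Implicit Defensive.

Import Order.TTheory GRing.Theory Num.Theory.

(* A partition is the sequence of its parts; the empty partition is allowed. *)
Definition strict_partition (la : seq nat) : bool :=
  sorted gtn la && all (leq 1) la.

(* Parts are numbered from 1, and part la r = 0 for r > size la. *)
Definition part (la : seq nat) (r : nat) : nat := nth 0 la r.-1.

(* Rows and columns are numbered from 1. For a strict partition               *)
(* part la r + r.-1 <= part la 1 when 0 < r <= size la, so no subtraction     *)
(* is truncated.                                                              *)
Definition in_diagram (la : seq nat) (r c : nat) : bool :=
  (1 <= r <= size la) &&
  (part la 1 - r.-1 - part la r + 1 <= c <= part la 1 - r.-1).

Definition cell (la : seq nat) : Type :=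
  {x : 'I_(size la).+1 * 'I_(part la 1).+1 | in_diagram la x.1 x.2}.

Definition row_of (la : seq nat) (x : cell la) : nat := (val x).1.
Definition col_of (la : seq nat) (x : cell la) : nat := (val x).2.

(* The values 0, ..., |la|-1 of a filling stand for the entries 1, ..., |la|. *)
Definition filling (la : seq nat) : Type := {ffun cell la -> 'I_(sumn la)}.

Definition entry (la : seq nat) (t : filling la) (x : cell la) : nat :=
  (t x : nat).+1.

Definition bijective_filling (la : seq nat) (t : filling la) : bool :=
  injectiveb t && [forall k, k \in codom t].

Definition row_increasing (la : seq nat) (t : filling la) : bool :=
  [forall x : cell la, forall y : cell la,
    (row_of x == row_of y) && (col_of x < col_of y) ==>
      (entry t x < entry t y)].

Definition col_increasing (la : seq nat) (t : filling la) : bool :=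
  [forall x : cell la, forall y : cell la,
    (col_of x == col_of y) && (row_of x < row_of y) ==>
      (entry t x < entry t y)].

Definition hrSYT (la : seq nat) : {set filling la} :=
  [set t | [&& bijective_filling t, row_increasing t & col_increasing t]].

Definition braid_hook (la : seq nat) (t : filling la) (k : nat) : bool :=
  [exists x : cell la, exists y : cell la, exists z : cell la,
    [&& (row_of y == row_of x) && (col_of y == (col_of x).+1),
        (row_of z == (row_of x).+1) && (col_of z == (col_of x).+1),
        ~~ in_diagram la (row_of x).+1 (col_of x),
        (entry t x).+1 == k, entry t y == k & entry t z == k.+1]].

(* A braid hook is an entry of t, hence at most |la|. *)
Definition num_braid_hooks (la : seq nat) (t : filling la) : nat :=
  #|[set k : 'I_(sumn la).+1 | braid_hook t k]|.

Local Open Scope ring_scope.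

Definition avg_braid_hooks (la : seq nat) : rat :=
  (\sum_(t in hrSYT la) (num_braid_hooks t)%:R) / #|hrSYT la|%:R.

(* Main.v *)
Require Import Defs.
From mathcomp Require Import all_boot all_order all_algebra all_fingroup.
From mathcomp Require Import zify ring lra.

Set Implicit Arguments.
Unset Strict Implicit.
Unset Printing Implicit Defensive.

Import Order.TTheory GRing.Theory Num.Theory.

(* Value j of a filling is the entry j + 1. Give a pair of cells the sign +1 if
   the second is the right neighbour of the first, -1 if it is the cell just
   below, 0 otherwise, and let S(k) be the sum over all tableaux of the sign of
   the pair of cells carrying k and k + 1. Look at the three cells carrying k,
   k + 1, k + 2 and permute them in all ways allowed by the order. If they do
   not form a chain, the contributions of such a class to S(k) - S(k+1) cancel:
   two cells covering, or covered by, a common cell have opposite signs. A chain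
   right-right or down-down contributes 0; a chain right-down of consecutive
   values is a braid hook and contributes 2; a chain down-right cannot have
   consecutive values, as the fourth corner of the square is a cell lying
   in between. Summing over k, twice the total number of braid hooks is
   S(0) - S(n-2), where S(0) is at most the number of tableaux and S(n-2) >= 0.
   If la_1 >= la_2 + 2, the two smallest entries are forced to start row 1, and
   if the last part is 1, the two largest entries are never adjacent. *)

(** * Linear extensions and the exchange of consecutive values *)

Section LinearExtensions.

Variables (T : finType) (n : nat) (R : rel T).

Definition linext : {set {ffun T -> 'I_n}} :=
  [set t : {ffun T -> 'I_n} |
    [&& injectiveb t, [forall k, k \in codom t] &
        [forall x, forall y, R x y ==> (t x < t y)]]].

Definition comparable x y := R x y || R y x.

Definition count2 k x y : nat :=
  \sum_(t in linext) ((t x == k :> nat) && (t y == k.+1 :> nat)).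

Definition count3 k x y z : nat :=
  \sum_(t in linext)
    [&& t x == k :> nat, t y == k.+1 :> nat & t z == k.+2 :> nat].

Lemma linextP t : t \in linext ->
  [/\ injective t, forall k, k < n -> exists x, t x = k :> nat &
      forall x y, R x y -> t x < t y].
Proof.
rewrite inE => /and3P[/injectiveP ti /forallP tc /forallP tR]; split=> //.
  by move=> k kn; have /codomP[x tx] := tc (Ordinal kn); exists x; rewrite -tx.
by move=> x y; exact/implyP/(forallP (tR x)).
Qed.

Lemma comparableC x y : comparable x y = comparable y x.
Proof. exact: orbC. Qed.

Lemma comparable_lt t x y :
  t \in linext -> comparable x y -> t x < t y -> R x y.
Proof. by move=> /linextP[_ _ tR] /orP[//|/tR]; lia. Qed.

Lemma between_eq (t : {ffun T -> 'I_n}) x y z w k : t \in linext ->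
  t x = k :> nat -> t y = k.+1 :> nat -> t z = k.+2 :> nat -> R x w -> R w z -> w = y.
Proof.
case/linextP => ti _ tR tx ty tz /tR; rewrite tx => xw /tR; rewrite tz => wz.
by apply/ti/val_inj/eqP; rewrite /= ty eqn_leq -ltnS wz xw.
Qed.

Lemma no_between (t : {ffun T -> 'I_n}) x y w k : t \in linext ->
  t x = k :> nat -> t y = k.+1 :> nat -> R x w -> ~ R w y.
Proof.
case/linextP => _ _ tR tx ty /tR; rewrite tx => xw /tR.
by rewrite ty ltnS leqNgt xw.
Qed.

(** The only value above n - 2 is n - 1, and [y] carries it. That value is written [(n - 2).+1] to
    match the pair of values k, k + 1 of a signed count at k = n - 2. *)
Lemma last_eq (t : {ffun T -> 'I_n}) x y w : 1 < n -> t \in linext ->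
  t x = n - 2 :> nat -> t y = (n - 2).+1 :> nat -> R x w -> w = y.
Proof.
move=> n1 /linextP[ti _ tR] tx ty /tR; rewrite tx => xw.
apply/ti/val_inj/eqP; rewrite /= ty eqn_leq xw andbT -ltnS.
have nE : n = (n - 2).+2 by lia.
by have := ltn_ord (t w); rewrite [X in _ < X]nE.
Qed.

Definition swap (i j : 'I_n) (t : {ffun T -> 'I_n}) : {ffun T -> 'I_n} :=
  [ffun x => tperm i j (t x)].

Lemma swapK i j : involutive (swap i j).
Proof. by move=> t; apply/ffunP => x; rewrite !ffunE tpermK. Qed.

Lemma tperm_lt (i j a b : 'I_n) : j = i.+1 :> nat ->
  a < b -> ~ (a = i /\ b = j) -> tperm i j a < tperm i j b.
Proof.
move=> ji; have neq (u v : 'I_n) : u <> v -> u <> v :> nat by move=> uv /val_inj.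
by case: tpermP => [->|->|/neq ? /neq ?]; case: tpermP => [->|->|/neq ? /neq ?] ab abE;
  rewrite ?ltnn in ab *; do ?[by case: abE]; lia.
Qed.

(** Exchanging two consecutive values reverses the order of no pair of cells but [x], [y], and [R]
    does not constrain that pair. *)
Lemma swap_linext (i j : 'I_n) (t : {ffun T -> 'I_n}) x y : j = i.+1 :> nat ->
  t x = i -> t y = j -> ~~ comparable x y -> t \in linext ->
  swap i j t \in linext.
Proof.
move=> ji tx ty xy tL; have [ti ts tR] := linextP tL.
rewrite inE; apply/and3P; split.
- by apply/injectiveP => u v; rewrite !ffunE => /perm_inj /ti.
- apply/forallP => k; have [u tu] := ts (tperm i j k) (ltn_ord _).
  by apply/codomP; exists u; rewrite ffunE (val_inj tu) tpermK.
apply/forallP => u; apply/forallP => v; apply/implyP => Ruv.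
rewrite !ffunE; apply: (tperm_lt ji) (tR _ _ Ruv) _.
rewrite -tx -ty => -[/ti ux /ti vy].
by move: xy; rewrite /comparable -ux -vy Ruv.
Qed.

Lemma leq_sum_linext (f : {ffun T -> 'I_n} -> {ffun T -> 'I_n})
    (B C : pred {ffun T -> 'I_n}) :
  injective f ->
  (forall t, t \in linext -> B t -> (f t \in linext) && C (f t)) ->
  \sum_(t in linext) B t <= \sum_(t in linext) C t.
Proof.
move=> fi fBC; have sumE (D : pred {ffun T -> 'I_n}) :
    \sum_(t in linext) D t = #|[set t in linext | D t]|.
  by rewrite -sum1dep_card big_mkcondr; apply: eq_bigr => t _; case: (D t).
rewrite !sumE -(card_imset _ fi); apply/subset_leq_card/subsetP => _ /imsetP[t + ->].
by rewrite in_set => /andP[tL Bt]; rewrite in_set fBC.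
Qed.

(** Exchanging the values k + 1 and k + 2 maps the tableaux counted on the left injectively to those
    counted on the right. The inequality so obtained holds for every incomparable pair, and
    interchanging [y] and [z] reverses it. *)
Lemma count3_swap23 k x y z :
  ~~ comparable y z -> count3 k x y z = count3 k x z y.
Proof.
wlog suff: y z / ~~ comparable y z -> count3 k x y z <= count3 k x z y.
  by move=> le yz; apply/eqP; rewrite eqn_leq !le // comparableC.
move=> yz; have [kn|kn] := ltnP k.+2 n; last first.
  rewrite /count3 big1 // => t _; apply/eqP; rewrite eqb0; apply/negP.
  by case/and3P => _ _ /eqP tz; have := ltn_ord (t z); lia.
pose i := Ordinal (ltnW kn); pose j := Ordinal kn.
apply: (leq_sum_linext (can_inj (swapK i j))) => t tL.
case/and3P => /eqP tx /eqP ty /eqP tz.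
rewrite (swap_linext _ _ _ yz) //=; try exact: val_inj.
rewrite !ffunE !permE /= -!val_eqE /= tx ty tz !eqxx /=.
have -> : (k == k.+1) = false by lia.
have -> : (k == k.+2) = false by lia.
have -> : (k.+2 == k.+1) = false by lia.
by rewrite /= tx !eqxx.
Qed.

Lemma count3_swap12 k x y z :
  ~~ comparable x y -> count3 k x y z = count3 k y x z.
Proof.
wlog suff: x y / ~~ comparable x y -> count3 k x y z <= count3 k y x z.
  by move=> le xy; apply/eqP; rewrite eqn_leq !le // comparableC.
move=> xy; have [kn|kn] := ltnP k.+1 n; last first.
  rewrite /count3 big1 // => t _; apply/eqP; rewrite eqb0; apply/negP.
  by case/and3P => _ /eqP ty _; have := ltn_ord (t y); lia.
pose i := Ordinal (ltnW kn); pose j := Ordinal kn.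
apply: (leq_sum_linext (can_inj (swapK i j))) => t tL.
case/and3P => /eqP tx /eqP ty /eqP tz.
rewrite (swap_linext _ _ _ xy) //=; try exact: val_inj.
rewrite !ffunE !permE /= -!val_eqE /= tx ty tz !eqxx /=.
have -> : (k.+1 == k) = false by lia.
have -> : (k.+2 == k) = false by lia.
have -> : (k.+2 == k.+1) = false by lia.
by rewrite /= tz !eqxx.
Qed.

Lemma sum_pick (t : {ffun T -> 'I_n}) k : t \in linext -> k < n ->
  \sum_x (t x == k :> nat) = 1.
Proof.
move=> /linextP[ti ts _] /ts[x tx]; rewrite (bigD1 x) //= tx eqxx big1 // => y yx.
by rewrite -tx; case: eqP => // /val_inj /ti yE; rewrite yE eqxx in yx.
Qed.

(** Every tableau has exactly one cell of value k + 2, which becomes the third cell. *)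
Lemma count2_sumr k x y : k.+2 < n -> count2 k x y = \sum_z count3 k x y z.
Proof.
move=> kn; rewrite exchange_big /=; apply: eq_bigr => t tL.
rewrite -[LHS]muln1 -(sum_pick tL kn) big_distrr /=.
by apply: eq_bigr => z _; rewrite andbA mulnb.
Qed.

Lemma count2_suml k y z : k.+2 < n -> count2 k.+1 y z = \sum_x count3 k x y z.
Proof.
move=> kn; rewrite exchange_big /=; apply: eq_bigr => t tL.
rewrite -[LHS]mul1n -(@sum_pick t k tL) ?big_distrl /=; last by lia.
by apply: eq_bigr => x _; rewrite mulnb.
Qed.

Lemma count3_neq0 k x y z : count3 k x y z != 0 ->
  exists2 t, t \in linext & [/\ t x = k :> nat, t y = k.+1 :> nat & t z = k.+2 :> nat].
Proof.
rewrite sum_nat_eq0 negb_forall_in => /exists_inP[t tL].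
by rewrite eqb0 negbK => /and3P[/eqP tx /eqP ty /eqP tz]; exists t.
Qed.

(** * Signed counts of pairs with consecutive values *)

Local Open Scope ring_scope.

Definition signed_count (s : T -> T -> int) (k : nat) : int :=
  \sum_x \sum_y s x y * (count2 k x y)%:R.

(** Adding a third cell turns both counts into sums over the same triples, with weights [s x y] and
    [s y z]. Triples with an incomparable pair cancel, either within one sum or against the other
    sum, and only chains survive. *)
Lemma signed_count_diff (s : T -> T -> int) k :
  (k.+2 < n)%N ->
  (forall x y, ~~ comparable x y -> s x y = 0) ->
  (forall x y z, count3 k x y z != 0%N -> comparable x y -> comparable x z ->
     ~~ comparable y z -> s x y + s x z = 0) ->
  (forall x y z, count3 k x y z != 0%N -> comparable x z -> comparable y z ->
     ~~ comparable x y -> s x z + s y z = 0) ->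
  signed_count s k - signed_count s k.+1 =
  \sum_x \sum_y \sum_(z | comparable x y && comparable y z)
     (s x y - s y z) * (count3 k x y z)%:R.
Proof.
move=> kn s0 sV sL.
pose N x y z : int := (count3 k x y z)%:R.
have N0 x y z (a : int) : (count3 k x y z != 0%N -> a = 0) -> a * N x y z = 0.
  rewrite /N; have [->|_ /(_ isT) ->] := eqVneq (count3 k x y z) 0%N.
    by rewrite mulr0.
  by rewrite mul0r.
have -> : signed_count s k = \sum_x \sum_y \sum_z s x y * N x y z.
  apply: eq_bigr => x _; apply: eq_bigr => y _.
  by rewrite count2_sumr // natr_sum big_distrr.
have -> : signed_count s k.+1 = \sum_x \sum_y \sum_z s y z * N x y z.
  rewrite exchange_big /=; rewrite /signed_count; apply: eq_bigr => y _.
  rewrite exchange_big; apply: eq_bigr => z _.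
  by rewrite count2_suml // natr_sum big_distrr.
(* The added cell is z in the [A] sums and x in the [B] sums. It is comparable with y in [A] and
   [B], only with the other cell of the signed pair in [A1] and [B1], and with neither in [A2] and
   [B2]. *)
pose c := comparable.
pose A x y z : int := (s x y * N x y z) *+ c y z.
pose A1 x y z : int := (s x y * N x y z) *+ (~~ c y z && c x z).
pose A2 x y z : int := (s x y * N x y z) *+ (~~ c y z && ~~ c x z).
pose B x y z : int := (s y z * N x y z) *+ c x y.
pose B1 x y z : int := (s y z * N x y z) *+ (~~ c x y && c x z).
pose B2 x y z : int := (s y z * N x y z) *+ (~~ c x y && ~~ c x z).
have split3 (D D0 D1 D2 : T -> T -> T -> int) :
    (forall x y z, D x y z = D0 x y z + D1 x y z + D2 x y z) ->
  \sum_x \sum_y \sum_z D x y z =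
  \sum_x \sum_y \sum_z D0 x y z + \sum_x \sum_y \sum_z D1 x y z +
  \sum_x \sum_y \sum_z D2 x y z.
  move=> DE; rewrite -!big_split; apply: eq_bigr => x _.
  rewrite -!big_split; apply: eq_bigr => y _.
  by rewrite -!big_split; apply: eq_bigr => z _.
rewrite (split3 (fun x y z => s x y * N x y z) A A1 A2); last first.
  by move=> x y z; rewrite /A /A1 /A2; case: (c y z); case: (c x z);
     rewrite /= !mulr0n !mulr1n ?addr0 ?add0r.
rewrite (split3 (fun x y z => s y z * N x y z) B B1 B2); last first.
  by move=> x y z; rewrite /B /B1 /B2; case: (c x y); case: (c x z);
     rewrite /= !mulr0n !mulr1n ?addr0 ?add0r.
have self_opp (a : int) : a = - a -> a = 0 by lia.
(* Interchanging y and z turns this sum into its opposite, by [sV]; for [B1] the same happens with x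
   and y, by [sL]. *)
have -> : \sum_x \sum_y \sum_z A1 x y z = 0.
  rewrite /A1.
  apply: big1 => x _; apply: self_opp; rewrite [LHS]exchange_big -sumrN /=.
  apply: eq_bigr => y _; rewrite -sumrN; apply: eq_bigr => z _.
  rewrite /c [comparable z y]comparableC.
  have [yz|yz] := boolP (comparable y z); first by rewrite /= !mulr0n oppr0.
  have [xy|/s0 xy] := boolP (comparable x y); last first.
    by rewrite xy mul0r !mul0rn oppr0 mulr0n.
  have [xz|/s0 xz] := boolP (comparable x z); last first.
    by rewrite xz mul0r !mul0rn oppr0.
  rewrite /N -(count3_swap23 _ _ yz) /= !mulr1n; apply/eqP; rewrite -addr_eq0 -mulrDl.
  by rewrite addrC N0 // => /sV; apply.
have -> : \sum_x \sum_y \sum_z B1 x y z = 0.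
  rewrite /B1.
  apply: self_opp; rewrite [LHS]exchange_big -sumrN /=.
  apply: eq_bigr => x _; rewrite -sumrN; apply: eq_bigr => y _.
  rewrite -sumrN; apply: eq_bigr => z _.
  rewrite /c [comparable y x]comparableC.
  have [xy|xy] := boolP (comparable x y); first by rewrite /= !mulr0n oppr0.
  have [xz|/s0 xz] := boolP (comparable x z); last first.
    by rewrite xz mul0r !mul0rn oppr0.
  have [yz|/s0 yz] := boolP (comparable y z); last first.
    by rewrite yz mul0r !mul0rn oppr0.
  rewrite /N -(count3_swap12 _ _ xy) /= !mulr1n; apply/eqP; rewrite -addr_eq0 -mulrDl.
  by rewrite N0 // => /sL; apply.
(* Two exchanges move a cell incomparable with both others from the last place to the first, which
   matches [A2] with [B2]. *)
have -> : \sum_x \sum_y \sum_z B2 x y z = \sum_x \sum_y \sum_z A2 x y z.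
  rewrite /A2 /B2.
  rewrite exchange_big; apply: eq_bigr => x _; rewrite exchange_big.
  apply: eq_bigr => y _; apply: eq_bigr => z _.
  rewrite /c [comparable z x]comparableC [comparable z y]comparableC andbC.
  have [yz|yz] := boolP (comparable y z); first by rewrite /= !mulr0n.
  have [xz|xz] := boolP (comparable x z); first by rewrite /= !mulr0n.
  by rewrite /= /N (count3_swap23 _ _ yz) (count3_swap12 _ _ xz).
rewrite !addr0 opprD addrACA subrr addr0 -sumrB; apply: eq_bigr => x _.
rewrite -sumrB; apply: eq_bigr => y _; rewrite -sumrB [RHS]big_mkcond; apply: eq_bigr => z _.
(* By [s0], an incomparable x, y contributes 0 to [A] and an incomparable y, z contributes 0 to [B],
   so both sums reduce to chains. *)
rewrite /A /B /c; have [xy|/s0 xy] := boolP (comparable x y);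
  have [yz|/s0 yz] := boolP (comparable y z);
  rewrite /= ?xy ?yz ?mul0r ?mulr0n ?mulr1n ?mul0rn ?subr0 //.
by rewrite mulrBl.
Qed.

Lemma sum_at (t : {ffun T -> 'I_n}) (F : T -> int) k x :
  t \in linext -> t x = k :> nat ->
  \sum_y F y * (t y == k :> nat)%:R = F x.
Proof.
move=> /linextP[ti _ _] tx; rewrite (bigD1 x) //= tx eqxx mulr1 big1 ?addr0 // => y yx.
rewrite -tx; case: eqP => [/val_inj /ti yE|]; last by rewrite mulr0.
by rewrite yE eqxx in yx.
Qed.

(** A form suited to estimates made one tableau at a time: [h t] is the sign of the two cells of [t]
    with values k and k + 1. *)
Lemma signed_countE (s : T -> T -> int) k : (k.+1 < n)%N ->
  exists2 h : {ffun T -> 'I_n} -> int,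
    signed_count s k = \sum_(t in linext) h t &
    forall t, t \in linext -> exists x y,
      [/\ t x = k :> nat, t y = k.+1 :> nat & h t = s x y].
Proof.
move=> kn; exists (fun t : {ffun T -> 'I_n} =>
  \sum_x \sum_y s x y * (t y == k.+1 :> nat)%:R * (t x == k :> nat)%:R).
  rewrite exchange_big; apply: eq_bigr => x _; rewrite exchange_big /=; apply: eq_bigr => y _.
  rewrite natr_sum mulr_sumr; apply: eq_bigr => t _.
  by rewrite -mulnb natrM mulrA mulrAC.
move=> t tL; have [_ ts _] := linextP tL.
have [x tx] := ts k (ltnW kn); have [y ty] := ts _ kn.
exists x, y; split=> //.
under eq_bigr do rewrite -mulr_suml.
by rewrite (sum_at (fun x => \sum_y s x y * (t y == k.+1 :> nat)%:R) tL tx) (sum_at (s x) tL ty).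
Qed.

Lemma sum3_at (t : {ffun T -> 'I_n}) (F : T -> T -> T -> int) i j k x y z :
  t \in linext -> t x = i :> nat -> t y = j :> nat -> t z = k :> nat ->
  \sum_x' \sum_y' \sum_z' F x' y' z' *
    [&& t x' == i :> nat, t y' == j :> nat & t z' == k :> nat]%:R = F x y z.
Proof.
move=> tL tx ty tz; rewrite -(sum_at (fun x' => F x' y z) tL tx).
apply: eq_bigr => x' _; rewrite -(sum_at (fun y' => F x' y' z) tL ty) mulr_suml.
apply: eq_bigr => y' _; rewrite -(sum_at (F x' y') tL tz) !mulr_suml.
by apply: eq_bigr => z' _; rewrite -!mulnb !natrM; ring.
Qed.

End LinearExtensions.

Lemma sumn_gt1 (la : seq nat) : part la 2 + 2 <= part la 1 -> 1 < sumn la.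
Proof. by rewrite /part; case: la => [|a [|b l]] /=; lia. Qed.

(** * Geometry of the half-right-justified diagram *)

Section Diagram.

Variables (la : seq nat) (hla : strict_partition la).

Implicit Types (x y z w : cell la) (t : filling la).

(** This relation is not transitive. It suffices because a chain of relations between cells of
    consecutive values has no room for an intermediate cell: such cells are ordered only if they are
    related directly. *)
Definition cell_lt x y : bool :=
  (row_of x == row_of y) && (col_of x < col_of y) ||
  (col_of x == col_of y) && (row_of x < row_of y).

Lemma hrSYT_linext : hrSYT la = linext (sumn la) cell_lt.
Proof.
apply/setP => t; rewrite !inE /bijective_filling -andbA; do 2 congr andb.
apply/andP/forallP => [[/forallP tr /forallP tc] x|tR].
  apply/forallP => y; apply/implyP => /orP[xy|xy].
    by have /implyP := forallP (tr x) y; apply.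
  by have /implyP := forallP (tc x) y; apply.
split; apply/forallP => x; apply/forallP => y; apply/implyP => xy;
  have /implyP := forallP (tR x) y; apply; rewrite /cell_lt xy ?orbT //.
Qed.

Lemma part_gt0 r : 0 < r <= size la -> 0 < part la r.
Proof.
by case: r => // r rs; have /andP[_ /all_nthP] := hla; apply.
Qed.

(** Strictness costs at least one per row. Hence, going down, the left ends of the rows move weakly
    to the right while the right ends move left by one, so columns have no gaps. *)
Lemma part_leq r q : 0 < r -> r <= q <= size la -> part la q + (q - r) <= part la r.
Proof.
move=> r0 /andP[rq qs]; rewrite -(subnK rq) addnK.
have : q - r + r <= size la by rewrite subnK.
elim: (q - r) => [|m IHm] ms; first by rewrite addn0.
have /IHm : m + r <= size la by lia.
suff : part la (m.+1 + r) < part la (m + r) by lia.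
have /andP[/(sortedP 0) srt _] := hla.
have := srt (m + r).-1; rewrite /part /= prednK; last by lia.
by apply; lia.
Qed.

Lemma in_diagram_row r c c' d :
  in_diagram la r c -> in_diagram la r c' -> c <= d <= c' -> in_diagram la r d.
Proof. rewrite /in_diagram; lia. Qed.

Lemma in_diagram_col r r' q c :
  in_diagram la r c -> in_diagram la r' c -> r <= q <= r' -> in_diagram la q c.
Proof.
rewrite /in_diagram => /andP[/andP[r0 rs] /andP[_ _]] /andP[/andP[_ r's] rc] /andP[rq qr'].
have q0 : 0 < q by lia.
have h1 : part la r' + (r' - q) <= part la q by apply: part_leq; lia.
have h2 : part la q + (q - 1) <= part la 1 by apply: part_leq; lia.
by move: rc h1 h2; move: (part la 1) (part la r') (part la q) => a b d; lia.
Qed.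

(** Row r ends one column to the right of row r + 1, so a cell with a cell below it also has a right
    neighbour. *)
Lemma in_diagram_right r c :
  0 < r -> in_diagram la r.+1 c -> in_diagram la r c -> in_diagram la r c.+1.
Proof. rewrite /in_diagram; lia. Qed.

Lemma cell_in x : in_diagram la (row_of x) (col_of x).
Proof. exact: valP x. Qed.

Lemma cell_eq x y : row_of x = row_of y -> col_of x = col_of y -> x = y.
Proof.
rewrite /row_of /col_of => rE cE; apply: val_inj.
by case: (val x) (val y) rE cE => [a b] [c d] /= /val_inj-> /val_inj->.
Qed.

Lemma cell_at r c : in_diagram la r c -> exists x, row_of x = r /\ col_of x = c.
Proof.
move=> rc; have rs : r < (size la).+1 by move: rc; rewrite /in_diagram; lia.
have cs : c < (part la 1).+1 by move: rc; rewrite /in_diagram; lia.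
by exists (Sub (Ordinal rs, Ordinal cs) rc).
Qed.

Definition step_sign x y : int :=
  if (row_of y == row_of x) && (col_of y == (col_of x).+1) then 1%R
  else if (col_of y == col_of x) && (row_of y == (row_of x).+1) then (-1)%R
  else 0%R.

(** If [y] were further along the row or column of [x], the neighbour of [x] in that direction would
    be a cell in between. *)
Lemma step_sign_cover x y : cell_lt x y -> (forall w, cell_lt x w -> ~ cell_lt w y) ->
  [/\ row_of y = row_of x, col_of y = (col_of x).+1 & step_sign x y = 1%R] \/
  [/\ col_of y = col_of x, row_of y = (row_of x).+1 & step_sign x y = (-1)%R].
Proof.
move=> xy noW; case/orP: (xy) => /andP[/eqP E lt]; [left|right].
  suff cE : col_of y = (col_of x).+1.
    by split=> //; rewrite /step_sign E cE !eqxx.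
  case: (ltngtP (col_of y) (col_of x).+1) => // h; first by lia.
  have [|w [wr wc]] := @cell_at (row_of x) (col_of x).+1.
    apply: (in_diagram_row (cell_in x) (c' := col_of y)); last by lia.
    by rewrite E; exact: cell_in.
  by case: (noW w); rewrite /cell_lt wr wc; lia.
suff rE : row_of y = (row_of x).+1.
  by split=> //; rewrite /step_sign E rE !eqxx andbC; case: ifP => //; lia.
case: (ltngtP (row_of y) (row_of x).+1) => // h; first by lia.
have [|w [wr wc]] := @cell_at (row_of x).+1 (col_of x).
  apply: (in_diagram_col (cell_in x) (r' := row_of y)); last by lia.
  by rewrite E; exact: cell_in.
by case: (noW w); rewrite /cell_lt wr wc; lia.
Qed.

Lemma step_sign_incomparable x y : ~~ comparable cell_lt x y -> step_sign x y = 0%R.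
Proof.
move=> xy; rewrite /step_sign.
case: ifPn => [h|_]; first by move: xy; rewrite /comparable /cell_lt; lia.
by case: ifPn => // h; move: xy; rewrite /comparable /cell_lt; lia.
Qed.

(** * Signs of cells carrying three consecutive values *)

Local Notation N := (sumn la).
Local Notation L := (linext N cell_lt).

(** A cell between [x] and [z] would carry k + 1, hence be [y], which is incomparable with [z]. So
    [y] and [z] are both neighbours of [x], and being distinct they are one to the right and one
    below. *)
Lemma step_sign_fork k x y z : count3 N cell_lt k x y z != 0 ->
  comparable cell_lt x y -> comparable cell_lt x z -> ~~ comparable cell_lt y z ->
  (step_sign x y + step_sign x z = 0)%R.
Proof.
case/count3_neq0 => t tL [tx ty tz] xy xz yz; have [ti _ _] := linextP tL.
have {}xy : cell_lt x y by apply: comparable_lt tL xy _; rewrite tx ty.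
have {}xz : cell_lt x z by apply: comparable_lt tL xz _; rewrite tx tz.
have yNz : y <> z by move=> yE; move: ty; rewrite yE tz; lia.
have := step_sign_cover xy (fun w => no_between tL tx ty (w := w)).
have [w xw wz||] := step_sign_cover xz.
  have wy := between_eq tL tx ty tz xw wz.
  by move: yz; rewrite /comparable -wy wz.
all: move=> [r1 c1 ->] [] [r2 c2 ->] //; case: yNz; apply: cell_eq; congruence.
Qed.

(** Dual to [step_sign_fork]: [x] and [y] are the left and upper neighbours of [z], in some
    order. *)
Lemma step_sign_join k x y z : count3 N cell_lt k x y z != 0 ->
  comparable cell_lt x z -> comparable cell_lt y z -> ~~ comparable cell_lt x y ->
  (step_sign x z + step_sign y z = 0)%R.
Proof.
case/count3_neq0 => t tL [tx ty tz] xz yz xy; have [ti _ _] := linextP tL.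
have {}xz : cell_lt x z by apply: comparable_lt tL xz _; rewrite tx tz.
have {}yz : cell_lt y z by apply: comparable_lt tL yz _; rewrite ty tz.
have xNy : x <> y by move=> xE; move: tx; rewrite xE ty; lia.
have := step_sign_cover yz (fun w => no_between tL ty tz (w := w)).
have [w xw wz||] := step_sign_cover xz.
  have wy := between_eq tL tx ty tz xw wz.
  by move: xy; rewrite /comparable -wy xw.
all: move=> [r1 c1 ->] [] [r2 c2 ->] //; case: xNy; apply: cell_eq; lia.
Qed.

Definition hook_shape x y z : bool :=
  [&& (row_of y == row_of x) && (col_of y == (col_of x).+1),
      (row_of z == (row_of x).+1) && (col_of z == (col_of x).+1) &
      ~~ in_diagram la (row_of x).+1 (col_of x)].

Lemma hook_shape_comparable x y z : hook_shape x y z ->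
  comparable cell_lt x y && comparable cell_lt y z.
Proof. rewrite /hook_shape /comparable /cell_lt; lia. Qed.

Lemma step_sign_chain k x y z : count3 N cell_lt k x y z != 0 ->
  comparable cell_lt x y -> comparable cell_lt y z ->
  (step_sign x y - step_sign y z = 2 * (hook_shape x y z)%:R)%R.
Proof.
case/count3_neq0 => t tL [tx ty tz] xy yz; have [ti _ _] := linextP tL.
have {}xy : cell_lt x y by apply: comparable_lt tL xy _; rewrite tx ty.
have {}yz : cell_lt y z by apply: comparable_lt tL yz _; rewrite ty tz.
have yw w : cell_lt x w -> cell_lt w z -> w = y.
  exact: between_eq tL tx ty tz.
have [] := step_sign_cover xy (fun w => no_between tL tx ty (w := w)) => -[r1 c1 ->];
have [] := step_sign_cover yz (fun w => no_between tL ty tz (w := w)) => -[r2 c2 ->];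
rewrite /hook_shape.
- by case: (boolP (_ && _)) => //; lia.
(* Right then down. If the lower left corner were a cell, it would lie between [x] and [z] and so
   equal [y]; the corner condition of a braid hook therefore holds by itself. *)
- rewrite r1 c1 r2 c2 r1 c1 !eqxx /=; case: (boolP (in_diagram _ _ _)) => //.
  case/cell_at => w [wr wc]; have wy : w = y by apply: yw; rewrite /cell_lt; lia.
  by move: wr; rewrite wy; lia.
(* Down then right. The upper right corner is a cell by [in_diagram_right], and it lies between [x]
   and [z] without being [y]. *)
- have [|w [wr wc]] := @cell_at (row_of x) (col_of x).+1.
    apply: in_diagram_right (cell_in x); first by have := cell_in x; rewrite /in_diagram; lia.
    by rewrite -c1 -r1; exact: cell_in.
  have wy : w = y by apply: yw; rewrite /cell_lt; lia.
  by move: wr; rewrite wy; lia.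
- by case: (boolP (_ && _)) => //; lia.
Qed.

(** * Braid hooks as a telescoping sum *)

Local Open Scope ring_scope.

Lemma step_sign_count k : (k.+2 < N)%N ->
  signed_count N cell_lt step_sign k - signed_count N cell_lt step_sign k.+1 =
  2 * \sum_x \sum_y \sum_z (hook_shape x y z)%:R * (count3 N cell_lt k x y z)%:R.
Proof.
move=> kN; rewrite signed_count_diff //; first last.
- exact: step_sign_join.
- exact: step_sign_fork.
- exact: step_sign_incomparable.
rewrite mulr_sumr; apply: eq_bigr => x _; rewrite mulr_sumr; apply: eq_bigr => y _.
rewrite mulr_sumr big_mkcond; apply: eq_bigr => z _; rewrite mulrA.
have [->|c0] := eqVneq (count3 N cell_lt k x y z) 0%N; first by rewrite !mulr0 if_same.
case: ifPn => [/andP[xy yz]|xyz]; first by rewrite (step_sign_chain c0).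
case: (boolP (hook_shape x y z)) => [/hook_shape_comparable|]; first by rewrite (negPf xyz).
by rewrite mulr0 mul0r.
Qed.

Lemma braid_hook_lt t k : t \in L ->
  braid_hook t k.+2 -> (k.+2 < N)%N.
Proof.
move=> tL /existsP[x /existsP[y /existsP[z]]].
rewrite /entry => /and5P[_ _ _ _ /andP[_]]; have := ltn_ord (t z); lia.
Qed.

(** Entries exceed values by one, so a hook at entry k + 2 has the values k, k + 1, k + 2. *)
Lemma braid_hook_sum t k : t \in L -> (k.+2 < N)%N ->
  (braid_hook t k.+2)%:R = \sum_x \sum_y \sum_z (hook_shape x y z)%:R *
    [&& t x == k :> nat, t y == k.+1 :> nat & t z == k.+2 :> nat]%:R :> int.
Proof.
move=> tL kN; have [ti ts _] := linextP tL.
have [x tx] := ts k (ltnW (ltnW kN)); have [y ty] := ts _ (ltnW kN).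
have [z tz] := ts _ kN.
transitivity ((hook_shape x y z)%:R : int).
  congr (nat_of_bool _)%:R; apply/existsP/idP => [[x' /existsP[y' /existsP[z']]]|xyz].
    rewrite /entry => /and5P[h1 h2 h3 /eqP[tx'] /andP[/eqP[ty'] /eqP[tz']]].
    have -> : x = x' by apply/ti/val_inj; exact: etrans tx (esym tx').
    have -> : y = y' by apply/ti/val_inj; exact: etrans ty (esym ty').
    have -> : z = z' by apply/ti/val_inj; exact: etrans tz (esym tz').
    by rewrite /hook_shape h1 h2 h3.
  exists x; apply/existsP; exists y; apply/existsP; exists z.
  by move: xyz => /and3P[-> -> ->]; rewrite /entry tx ty tz !eqxx.
by rewrite (sum3_at (fun x y z => (hook_shape x y z)%:R) tL tx ty tz).
Qed.

Lemma braid_hook01 t k : (k < 2)%N -> braid_hook t k = false.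
Proof.
move=> k2; apply/existsP => -[x /existsP[y /existsP[z]]].
by rewrite /entry => /and5P[_ _ _ /eqP tx _]; lia.
Qed.

(** Of the candidates 0, ..., N, the first two leave no room for a preceding entry and N leaves none
    for a following one; 2, ..., N - 1 remain. *)
Lemma num_braid_hooks_sum t : t \in L ->
  (num_braid_hooks t)%:R = \sum_(0 <= k < N - 2) (braid_hook t k.+2)%:R :> int.
Proof.
move=> tL; rewrite /num_braid_hooks -sum1dep_card big_mkcond /=.
rewrite (eq_bigr (fun k : 'I_N.+1 => braid_hook t k : nat)); last by move=> k _; case: ifP.
rewrite -(big_mkord xpredT (fun k => braid_hook t k : nat)) natr_sum.
have := fun k => @braid_hook_lt t k tL; have := @braid_hook01 t.
move: (braid_hook t) => b; case: N => [|[|n]] b01 bE.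
- by rewrite [RHS]big_geq // big_nat1 b01.
- by rewrite [RHS]big_geq // big_nat_recl // big_nat1 !b01.
rewrite subSS subSS subn0 big_nat_recl // b01 // big_nat_recl // b01 // !add0r.
rewrite big_nat_recr //= -[RHS]addr0; congr (_ + _).
by case E: (b _) => //; have := bE _ E; rewrite ltnn.
Qed.

(** Telescoping of [step_sign_count] over k < N - 2. For N at most 2 the truncated difference is 0
    and both sides vanish. *)
Lemma braid_hooks_signed_count :
  2 * \sum_(t in L) (num_braid_hooks t)%:R =
  signed_count N cell_lt step_sign 0 - signed_count N cell_lt step_sign (N - 2).
Proof.
rewrite -[RHS]opprB -telescope_sumr // -sumrN.
rewrite (eq_bigr _ num_braid_hooks_sum) exchange_big mulr_sumr.
apply: eq_big_nat => k /andP[_ kN]; have {}kN : (k.+2 < N)%N by lia.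
rewrite opprB step_sign_count //; congr (_ * _).
rewrite (eq_bigr _ (fun t tL => braid_hook_sum tL kN)).
rewrite exchange_big; apply: eq_bigr => x _.
rewrite exchange_big; apply: eq_bigr => y _.
rewrite exchange_big; apply: eq_bigr => z _.
by rewrite natr_sum mulr_sumr.
Qed.

(** * The signed counts at the two ends *)

Lemma signed_count_first_le : (1 < N)%N ->
  signed_count N cell_lt step_sign 0 <= #|L|%:R.
Proof.
move=> N1; have [h -> hE] := signed_countE cell_lt step_sign N1.
rewrite -sum1_card natr_sum; apply: ler_sum => t /hE[x [y [_ _ ->]]].
by rewrite /step_sign; case: ifP => // _; case: ifP.
Qed.

(* If the last two values lay in x and the cell below it, the right neighbour
   of x, which exists, would have no larger value left. *)
Lemma signed_count_last_ge0 : (1 < N)%N ->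
  0 <= signed_count N cell_lt step_sign (N - 2).
Proof.
move=> N1; have N2 : ((N - 2).+1 < N)%N by lia.
have [h -> hE] := signed_countE cell_lt step_sign N2.
apply: sumr_ge0 => t tL; have [x [y [tx ty ->]]] := hE t tL.
rewrite /step_sign; case: ifP => // _; case: ifP => // /andP[/eqP yc /eqP yr].
have [|w [wr wc]] := @cell_at (row_of x) (col_of x).+1.
  apply: in_diagram_right (cell_in x); first by have := cell_in x; rewrite /in_diagram; lia.
  by rewrite -yc -yr; exact: cell_in.
have wy : w = y by apply: last_eq N1 tL tx ty _; rewrite /cell_lt wr wc; lia.
by move: wr; rewrite wy; lia.
Qed.

Lemma braid_hooks_le :
  2 * \sum_(t in L) (num_braid_hooks t)%:R <= #|L|%:R :> int.
Proof.
rewrite braid_hooks_signed_count; have [N1|N1] := ltnP 1 N.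
  by have := signed_count_first_le N1; have := signed_count_last_ge0 N1; lia.
(* For N at most 1 the two end counts coincide. *)
by rewrite (_ : (N - 2)%N = 0%N) ?subrr ?ler0n //; lia.
Qed.

(** By the gap, row 2 and hence every lower row starts in column 2 or later. So (1,1) precedes every
    other cell and (1,2) precedes all the remaining ones, which fixes the places of the values 0 and
    1. *)
Lemma signed_count_first : (part la 2 + 2 <= part la 1)%N ->
  signed_count N cell_lt step_sign 0 = #|L|%:R.
Proof.
move=> gap; have N1 := sumn_gt1 gap.
have size0 : (0 < size la)%N by move: gap; rewrite /part; case: la => //=; lia.
have top c : (0 < c <= part la 1)%N -> in_diagram la 1%N c by rewrite /in_diagram; lia.
have [|p [pr pc]] := @cell_at 1%N 1%N; first by apply: top; lia.
have [|q [qr qc]] := @cell_at 1%N 2%N; first by apply: top; lia.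
have [h -> hE] := signed_countE cell_lt step_sign N1.
rewrite -sum1_card natr_sum; apply: eq_bigr => t tL.
have [x [y [tx ty ->]]] := hE t tL; have [ti _ tR] := linextP tL.
(* The witness is the top cell of the column of [w]; the gap keeps it out of column 1. *)
have above w : (1 < row_of w)%N -> exists2 v, cell_lt v w & row_of v = 1%N /\ (1 < col_of v)%N.
  move=> w1; have := cell_in w; rewrite /in_diagram => win.
  have := @part_leq 2%N (row_of w) isT; have := @part_leq 1%N (row_of w) isT => h1 h2.
  have [|v [vr vc]] := @cell_at 1%N (col_of w); first by apply: top; lia.
  by exists v; [rewrite /cell_lt vr vc; lia | split=> //; lia].
have row0 w : (0 < row_of w)%N by have := cell_in w; rewrite /in_diagram; lia.
have col0 w : (0 < col_of w)%N by have := cell_in w; rewrite /in_diagram; lia.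
have pmin w : w <> p -> (t p < t w)%N.
  move=> wp; have [/above[v /tR vw [vr vc]]|w1] := ltnP 1 (row_of w).
    by apply: ltn_trans vw; apply: tR; rewrite /cell_lt pr pc vr; lia.
  apply: tR; suff : col_of w <> 1%N by rewrite /cell_lt pr pc; have := row0 w; have := col0 w; lia.
  by move=> wc; apply: wp; apply: cell_eq; rewrite ?pr ?pc //; have := row0 w; lia.
have qmin w : w <> p -> w <> q -> (t q < t w)%N.
  move=> wp wq; have [/above[v /tR vw [vr vc]]|w1] := ltnP 1 (row_of w).
    have [->//|/eqP vq] := eqVneq q v.
    apply: ltn_trans vw; apply: tR; suff : col_of v <> 2%N by rewrite /cell_lt qr qc vr; lia.
    by move=> vc2; apply: vq; apply: cell_eq; rewrite ?qr ?qc.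
  have wr : row_of w = 1%N by have := row0 w; lia.
  have wc1 : col_of w <> 1%N by move=> wc; apply: wp; apply: cell_eq; congruence.
  have wc2 : col_of w <> 2%N by move=> wc; apply: wq; apply: cell_eq; congruence.
  by apply: tR; rewrite /cell_lt qr qc wr; have := col0 w; lia.
have xp : x = p by have [//|/eqP/pmin] := eqVneq x p; rewrite tx.
have yp : y <> p by move=> yp; move: tx ty; rewrite xp yp => ->.
have yq : y = q.
  have [//|/eqP /(qmin _ yp)] := eqVneq y q; rewrite ty ltnS leqn0 => /eqP tq.
  by have /ti qp : t q = t p; [apply: val_inj; rewrite /= tq -xp tx | move: qc; rewrite qp pc].
by rewrite /step_sign xp yq pr qr pc qc.
Qed.

(** As the count is nonnegative, it is enough to exclude a step to the right from [x] to [y] at the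
    last two values. There [y] would be the only cell above [x] in the order, so a second one gives
    a contradiction. *)
Lemma signed_count_last : (1 < N)%N -> part la (size la) = 1%N ->
  signed_count N cell_lt step_sign (N - 2) = 0.
Proof.
move=> N1 last1; apply/eqP; rewrite eq_le signed_count_last_ge0 // andbT.
have N2 : ((N - 2).+1 < N)%N by lia.
have [h -> hE] := signed_countE cell_lt step_sign N2.
apply: sumr_le0 => t tL; have [x [y [tx ty ->]]] := hE t tL.
rewrite /step_sign; case: ifP => [/andP[/eqP yr /eqP yc]|_]; last by case: ifP.
suff [w xw wy] : exists2 w, cell_lt x w & w <> y.
  by case: wy; exact: last_eq N1 tL tx ty xw.
have := cell_in x; have := cell_in y; rewrite {1 2}/in_diagram yr yc => yin xin.
have := @part_gt0 (row_of x).+1 => p0.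
(* If [y] does not end its row, its right neighbour is the second cell. Otherwise the column of [x]
   is where the next row ends, so the cell below [x] serves; in the last row, of length 1, no step
   to the right exists. *)
have [yend|yend] := ltnP (col_of x).+1 (part la 1 - (row_of x).-1).
  have [|w [wr wc]] := @cell_at (row_of x) (col_of x).+2; first by rewrite /in_diagram; lia.
  by exists w; [rewrite /cell_lt wr wc; lia | move=> wy; move: wc; rewrite wy yc; lia].
have [rl|rl] := ltnP (row_of x) (size la); last first.
  have rE : row_of x = size la by lia.
  by move: yin xin; rewrite rE last1; lia.
have [|w [wr wc]] := @cell_at (row_of x).+1 (col_of x); first by rewrite /in_diagram; lia.
by exists w; [rewrite /cell_lt wr wc; lia | move=> wy; move: wr; rewrite wy yr; lia].
Qed.

(** * Existence of a tableau: the row reading filling *)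

Lemma row_reading_proof x :
  (flatten_index la (row_of x).-1
     (col_of x - (part la 1 - (row_of x).-1 - part la (row_of x) + 1)) < N)%N.
Proof.
clear hla; apply: flatten_indexP; rewrite -/(part la (row_of x)).
by have := cell_in x; rewrite /in_diagram; lia.
Qed.

Definition row_reading : filling la := [ffun x => Ordinal (row_reading_proof x)].

Lemma row_reading_linext : row_reading \in L.
Proof.
have lo x : (col_of x - (part la 1 - (row_of x).-1 - part la (row_of x) + 1)
              < nth 0 la (row_of x).-1)%N.
  rewrite -/(part la (row_of x)).
  by have := cell_in x; rewrite /in_diagram; lia.
rewrite inE; apply/and3P; split.
- apply/injectiveP => x y; rewrite !ffunE => /(congr1 val) /= xy.
  have rE : (row_of x).-1 = (row_of y).-1.
    by rewrite -(flatten_indexKl (lo x)) xy flatten_indexKl.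
  have := flatten_indexKr (lo x); rewrite xy flatten_indexKr // => cE.
  have xin := cell_in x; have yin := cell_in y; move: xin yin cE; rewrite /in_diagram => xin yin.
  have {}rE : row_of x = row_of y by lia.
  by rewrite rE in xin * => cE; apply: cell_eq => //; lia.
- apply/forallP => k; apply/codomP.
  have := reshape_indexP (ltn_ord k); have := reshape_offsetP (ltn_ord k).
  have := reshape_indexK la k.
  move: (reshape_index la k) (reshape_offset la k) => r c kE cr rs.
  (* The preimage of [k] is at offset [c] from the left end of row r + 1, since [reshape_index]
     numbers rows from 0. *)
  have [|x [xr xc]] := @cell_at r.+1 (part la 1 - r - part la r.+1 + 1 + c)%N.
    rewrite /in_diagram /= rs /=; have := @part_leq 1%N r.+1 isT.
    have : (c < part la r.+1)%N by [].
    by lia.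
  by exists x; apply: val_inj; rewrite ffunE /= xr xc /= addKn kE.
apply/forallP => x; apply/forallP => y; apply/implyP => xy; rewrite !ffunE /=.
rewrite /flatten_index.
have xin := cell_in x; have yin := cell_in y.
case/orP: xy => /andP[/eqP E lt].
  by rewrite E ltn_add2l; move: xin yin; rewrite /in_diagram E; lia.
(* Values in the row of [x] stay below the sum of the parts up to that row, and every later row
   starts at or above this sum. *)
apply: (@leq_trans (sumn (take (row_of x) la))).
  have := lo x; case: (row_of x) xin => [|r] // /andP[/andP[_ rs] _] /= h.
  by rewrite (take_nth 0%N) // -cats1 sumn_cat /= addn0 ltn_add2l.
apply: leq_trans (leq_addr _ _).
have -> : (row_of y).-1 = (row_of x + ((row_of y).-1 - row_of x))%N by lia.
by rewrite takeD sumn_cat leq_addr.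
Qed.

End Diagram.

Theorem theorem4p2 (la : seq nat) (hla : strict_partition la) :
  (avg_braid_hooks la <= 1 / 2)%R /\
  ((part la 2 + 2 <= part la 1)%N -> part la (size la) = 1%N ->
   avg_braid_hooks la = (1 / 2)%R).
Proof.
rewrite /avg_braid_hooks hrSYT_linext -natr_sum.
set H := (\sum_(t in _) _)%N; set f := #|_|.
have HE : (\sum_(t in linext (sumn la) (@cell_lt la)) (num_braid_hooks t)%:R = H%:R :> int)%R.
  by rewrite natr_sum.
(* A tableau exists, so the average is not the default value of a division by 0. *)
have f0 : 0 < f.
  by apply/card_gt0P; exists (row_reading la); exact: row_reading_linext hla.
have fQ : (0 < f%:R :> rat)%R by rewrite ltr0n.
split.
  have := braid_hooks_le hla; rewrite HE -/f => Hf.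
  have {}Hf : 2 * H <= f by lia.
  have : ((2 * H)%:R <= f%:R :> rat)%R by rewrite ler_nat.
  by rewrite ler_pdivrMr // natrM; lra.
move=> gap last1; have N1 := sumn_gt1 gap.
have := braid_hooks_signed_count hla; rewrite HE signed_count_last // signed_count_first // subr0 -/f => Hf.
have fE : f = 2 * H by lia.
have H0 : (H%:R != 0 :> rat)%R by rewrite pnatr_eq0; lia.
by rewrite fE natrM; field.
Qed.
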